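(* Each of the following subsets of $TLeib_8$ is a single orbit (i.e. any two of its members are isomorphic and it contains every algebra of $TLeib_8$ isomorphic to one of its members), with the indicated representative: $U_8^5$: $L(1,0,0,0,1,0,0,0,0,1)$; $U_8^6$: $L(0,0,0,0,1,0,0,0,0,1)$; $U_8^7$: $L(1,0,0,0,0,1,0,0,0,1)$; $U_8^8$: $L(0,0,0,0,0,1,0,0,0,1)$; $U_8^9$: $L(1,0,0,0,0,0,0,0,0,1)$; $U_8^{10}$: $L(0,0,0,0,0,0,0,0,0,1)$; $U_8^{17}$: $L(1,0,0,0,0,0,0,1,0,0)$; $U_8^{18}$: $L(0,0,0,0,0,0,0,1,0,0)$; $U_8^{29}$: $L(1,0,0,1,0,0,0,0,0,0)$; $U_8^{30}$: $L(0,0,0,1,0,0,0,0,0,0)$; $U_8^{34}$: $L(1,0,0,0,1,0,0,0,0,0)$; $U_8^{35}$: $L(0,0,0,0,1,0,0,0,0,0)$; $U_8^{38}$: $L(1,0,1,0,0,0,0,0,0,0)$; $U_8^{39}$: $L(0,0,1,0,0,0,0,0,0,0)$; $U_8^{41}$: $L(0,1,0,0,0,1,0,0,0,0)$; $U_8^{42}$: $L(0,1,0,0,0,0,0,0,0,0)$; $U_8^{44}$: $L(1,0,0,0,0,1,0,0,0,0)$; $U_8^{45}$: $L(0,0,0,0,0,1,0,0,0,0)$; $U_8^{46}$: $L(1,0,0,0,0,0,1,0,0,0)$; $U_8^{47}$: $L(0,0,0,0,0,0,1,0,0,0)$; $U_8^{48}$: $L(1,0,0,0,0,0,0,0,0,0)$;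 $U_8^{49}$: $L(0,0,0,0,0,0,0,0,0,0)$.
   Context: All algebras are over $\mathbb{C}$. For $C=(c_{0,0},c_{0,1},c_{1,1},c_{1,2},c_{1,3},c_{1,4},c_{1,5},c_{2,3},c_{2,4},c_{3,4})\in\mathbb{C}^{10}$, $L(C)$ denotes the $8$-dimensional complex algebra with basis $e_0,\dots,e_7$ and products (products of basis vectors not listed are zero): $[e_i,e_0]=e_{i+1}$ for $1\le i\le 6$; $[e_0,e_i]=-e_{i+1}$ for $2\le i\le 6$; $[e_0,e_0]=c_{0,0}e_7$; $[e_0,e_1]=-e_2+c_{0,1}e_7$; $[e_1,e_1]=c_{1,1}e_7$; $[e_1,e_2]=-[e_2,e_1]=c_{1,2}e_4+c_{1,3}e_5+c_{1,4}e_6+c_{1,5}e_7$; $[e_1,e_3]=-[e_3,e_1]=c_{1,2}e_5+c_{1,3}e_6+c_{1,4}e_7$; $[e_1,e_4]=-[e_4,e_1]=(c_{1,2}-c_{2,3})e_6+(c_{1,3}-c_{2,4})e_7$; $[e_1,e_5]=-[e_5,e_1]=(c_{1,2}-2c_{2,3})e_7$; $[e_2,e_3]=-[e_3,e_2]=c_{2,3}e_6+c_{2,4}e_7$; $[e_2,e_4]=-[e_4,e_2]=c_{2,3}e_7$; $[e_i,e_{7-i}]=-[e_{7-i},e_i]=(-1)^ic_{3,4}e_7$ for $1\le i\le 6$. $TLeib_8$ is the set of all $L(C)$ with $c_{3,4}(c_{2,3}+2c_{1,2})=0$ (the condition for $L(C)$ to be a Leibniz algebra, i.e. to satisfy $[x,[y,z]]=[[x,y],z]-[[x,z],y]$).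 ''Isomorphic'' means isomorphic as algebras over $\mathbb{C}$. The subsets are the sets of $L(C)\in TLeib_8$ satisfying the following conditions. With $c_{3,4}\neq0$ and $c_{1,1}=c_{0,1}=c_{1,2}=0$ in each of the first six cases: $U_8^5$: $c_{1,3}\ne0$, $c_{1,4}=0$, $c_{0,0}\ne0$. $U_8^6$: $c_{1,3}\ne0$, $c_{1,4}=c_{0,0}=0$. $U_8^7$: $c_{1,3}=0$, $c_{1,4}\ne0$, $c_{0,0}\ne0$. $U_8^8$: $c_{1,3}=0$, $c_{1,4}\ne0$, $c_{0,0}=0$. $U_8^9$: $c_{1,3}=c_{1,4}=0$, $c_{0,0}\ne0$. $U_8^{10}$: $c_{1,3}=c_{1,4}=0$, $c_{0,0}=0$. With $c_{3,4}=0$ in all remaining cases: $U_8^{17}$: $c_{2,3}\ne0$, $c_{1,1}=c_{0,1}=c_{1,2}=c_{1,3}=0$, $c_{0,0}\ne0$. $U_8^{18}$: $c_{2,3}\ne0$, $c_{1,1}=c_{0,1}=c_{1,2}=c_{1,3}=c_{0,0}=0$. $U_8^{29}$: $c_{2,3}=c_{2,4}=0$, $c_{1,2}\ne0$, $4c_{1,4}c_{1,2}-5c_{1,3}^2=0$, $-7c_{1,3}^3+4c_{1,5}c_{1,2}^2=0$, $c_{1,1}=c_{0,1}=0$, $c_{0,0}\ne0$. $U_8^{30}$: $c_{2,3}=c_{2,4}=0$, $c_{1,2}\ne0$, $4c_{1,4}c_{1,2}-5c_{1,3}^2=0$, $-7c_{1,3}^3+4c_{1,5}c_{1,2}^2=0$,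 $c_{1,1}=c_{0,1}=c_{0,0}=0$. $U_8^{34}$: $c_{2,3}=c_{2,4}=c_{1,2}=0$, $c_{1,3}\ne0$, $c_{1,4}=c_{1,1}=c_{0,1}=0$, $c_{0,0}\ne0$. $U_8^{35}$: $c_{2,3}=c_{2,4}=c_{1,2}=0$, $c_{1,3}\ne0$, $c_{1,4}=c_{1,1}=c_{0,1}=c_{0,0}=0$. $U_8^{38}$: $c_{2,3}=c_{2,4}=c_{1,2}=c_{1,3}=0$, $c_{1,1}\ne0$, $c_{1,5}=c_{1,4}=0$, $4c_{0,0}c_{1,1}-c_{0,1}^2\ne0$. $U_8^{39}$: $c_{2,3}=c_{2,4}=c_{1,2}=c_{1,3}=0$, $c_{1,1}\ne0$, $c_{1,5}=c_{1,4}=0$, $4c_{0,0}c_{1,1}-c_{0,1}^2=0$. $U_8^{41}$: $c_{2,3}=c_{2,4}=c_{1,2}=c_{1,3}=c_{1,1}=0$, $c_{0,1}\ne0$, $c_{1,5}=0$, $c_{1,4}\ne0$. $U_8^{42}$: $c_{2,3}=c_{2,4}=c_{1,2}=c_{1,3}=c_{1,1}=0$, $c_{0,1}\ne0$, $c_{1,5}=c_{1,4}=0$. $U_8^{44}$: $c_{2,3}=c_{2,4}=c_{1,2}=c_{1,3}=c_{1,1}=c_{0,1}=0$, $c_{1,4}\ne0$, $c_{1,5}=0$, $c_{0,0}\ne0$. $U_8^{45}$: $c_{2,3}=c_{2,4}=c_{1,2}=c_{1,3}=c_{1,1}=c_{0,1}=0$, $c_{1,4}\ne0$, $c_{1,5}=c_{0,0}=0$.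 $U_8^{46}$: $c_{2,3}=c_{2,4}=c_{1,2}=c_{1,3}=c_{1,1}=c_{0,1}=c_{1,4}=0$, $c_{1,5}\ne0$, $c_{0,0}\ne0$. $U_8^{47}$: $c_{2,3}=c_{2,4}=c_{1,2}=c_{1,3}=c_{1,1}=c_{0,1}=c_{1,4}=0$, $c_{1,5}\ne0$, $c_{0,0}=0$. $U_8^{48}$: $c_{2,3}=c_{2,4}=c_{1,2}=c_{1,3}=c_{1,1}=c_{0,1}=c_{1,4}=c_{1,5}=0$, $c_{0,0}\ne0$. $U_8^{49}$: $c_{2,3}=c_{2,4}=c_{1,2}=c_{1,3}=c_{1,1}=c_{0,1}=c_{1,4}=c_{1,5}=c_{0,0}=0$. *)

(* Defs.v *)
From HB Require Import structures.
From mathcomp Require Import all_boot all_order all_algebra.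
From mathcomp Require Export reals.
From mathcomp Require Export complex.

Set Implicit Arguments.
Unset Strict Implicit.
Unset Printing Implicit Defensive.

Import GRing.Theory.
Local Open Scope ring_scope.

(* An algebra (not necessarily associative or unital) over K is an lmodType K
   with a product; every product used below is bilinear by construction. *)
Definition alg_isomorphic (K : fieldType) (V W : lmodType K)
    (mulV : V -> V -> V) (mulW : W -> W -> W) : Prop :=
  exists f : {linear V -> W},
    bijective f /\ forall x y : V, f (mulV x y) = mulW (f x) (f y).

(* The fields are in the order in which the tuple C is written, so that the
   algebra L(a0, ..., a9) has parameters [Params a0 ... a9]. *)
Record params (K : fieldType) : Type := Params {
  c00 : K; c01 : K; c11 : K; c12 : K; c13 : K;
  c14 : K; c15 : K; c23 : K; c24 : K; c34 : K }.

Definition e (K : fieldType) (k : nat) : 'rV[K]_8 := delta_mx 0 (inord k).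

(* [bracket C i j] is [e_i, e_j] in L(C), for i, j <= 7. *)
Definition bracket (K : fieldType) (C : params K) (i j : nat) : 'rV[K]_8 :=
  match i, j with
  | 0%N, 0%N => c00 C *: e K 7
  | 0%N, 1%N => - e K 2 + c01 C *: e K 7
  | 0%N, _ => if (j <= 6)%N then - e K j.+1 else 0
  | _, 0%N => if (i <= 6)%N then e K i.+1 else 0
  | 1%N, 1%N => c11 C *: e K 7
  | 1%N, 2%N =>
      c12 C *: e K 4 + c13 C *: e K 5 + c14 C *: e K 6 + c15 C *: e K 7
  | 2%N, 1%N =>
      - (c12 C *: e K 4 + c13 C *: e K 5 + c14 C *: e K 6 + c15 C *: e K 7)
  | 1%N, 3%N => c12 C *: e K 5 + c13 C *: e K 6 + c14 C *: e K 7
  | 3%N, 1%N => - (c12 C *: e K 5 + c13 C *: e K 6 + c14 C *: e K 7)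
  | 1%N, 4%N => (c12 C - c23 C) *: e K 6 + (c13 C - c24 C) *: e K 7
  | 4%N, 1%N => - ((c12 C - c23 C) *: e K 6 + (c13 C - c24 C) *: e K 7)
  | 1%N, 5%N => (c12 C - 2 * c23 C) *: e K 7
  | 5%N, 1%N => - ((c12 C - 2 * c23 C) *: e K 7)
  | 2%N, 3%N => c23 C *: e K 6 + c24 C *: e K 7
  | 3%N, 2%N => - (c23 C *: e K 6 + c24 C *: e K 7)
  | 2%N, 4%N => c23 C *: e K 7
  | 4%N, 2%N => - (c23 C *: e K 7)
  (* Here i, j >= 1.  Since (-1)^(7-i) = - (-1)^i, this single formula covers
     both [e_i, e_(7-i)] and [e_(7-i), e_i] = - [e_i, e_(7-i)]. *)
  | _, _ => if (i + j == 7)%N then ((-1) ^+ i * c34 C) *: e K 7 else 0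
  end.

Definition L (K : fieldType) (C : params K) (x y : 'rV[K]_8) : 'rV[K]_8 :=
  \sum_(i < 8) \sum_(j < 8) (x 0 i * y 0 j) *: bracket C i j.

Definition L_isomorphic (K : fieldType) (C D : params K) : Prop :=
  alg_isomorphic (L C) (L D).

(* Distinct parameters give distinct products, so sets of algebras L(C) are
   represented as predicates on the parameters C. *)
Definition TLeib8 (K : fieldType) (C : params K) : Prop :=
  c34 C * (c23 C + 2 * c12 C) = 0.

Definition single_orbit (K : fieldType) (U : params K -> Prop)
    (C0 : params K) : Prop :=
  [/\ U C0,
      forall C D : params K, U C -> U D -> L_isomorphic C D
    & forall C D : params K, U C -> TLeib8 D -> L_isomorphic C D -> U D].

Section Subsets.
Variable K : fieldType.
Implicit Type C : params K.

Definition U5 C : Prop :=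
  TLeib8 C /\ c34 C <> 0 /\ c11 C = 0 /\ c01 C = 0 /\ c12 C = 0 /\
  c13 C <> 0 /\ c14 C = 0 /\ c00 C <> 0.

Definition U6 C : Prop :=
  TLeib8 C /\ c34 C <> 0 /\ c11 C = 0 /\ c01 C = 0 /\ c12 C = 0 /\
  c13 C <> 0 /\ c14 C = 0 /\ c00 C = 0.

Definition U7 C : Prop :=
  TLeib8 C /\ c34 C <> 0 /\ c11 C = 0 /\ c01 C = 0 /\ c12 C = 0 /\
  c13 C = 0 /\ c14 C <> 0 /\ c00 C <> 0.

Definition U8 C : Prop :=
  TLeib8 C /\ c34 C <> 0 /\ c11 C = 0 /\ c01 C = 0 /\ c12 C = 0 /\
  c13 C = 0 /\ c14 C <> 0 /\ c00 C = 0.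

Definition U9 C : Prop :=
  TLeib8 C /\ c34 C <> 0 /\ c11 C = 0 /\ c01 C = 0 /\ c12 C = 0 /\
  c13 C = 0 /\ c14 C = 0 /\ c00 C <> 0.

Definition U10 C : Prop :=
  TLeib8 C /\ c34 C <> 0 /\ c11 C = 0 /\ c01 C = 0 /\ c12 C = 0 /\
  c13 C = 0 /\ c14 C = 0 /\ c00 C = 0.

Definition U17 C : Prop :=
  TLeib8 C /\ c34 C = 0 /\ c23 C <> 0 /\ c11 C = 0 /\ c01 C = 0 /\
  c12 C = 0 /\ c13 C = 0 /\ c00 C <> 0.

Definition U18 C : Prop :=
  TLeib8 C /\ c34 C = 0 /\ c23 C <> 0 /\ c11 C = 0 /\ c01 C = 0 /\
  c12 C = 0 /\ c13 C = 0 /\ c00 C = 0.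

Definition U29 C : Prop :=
  TLeib8 C /\ c34 C = 0 /\ c23 C = 0 /\ c24 C = 0 /\ c12 C <> 0 /\
  4 * c14 C * c12 C - 5 * c13 C ^+ 2 = 0 /\
  - 7 * c13 C ^+ 3 + 4 * c15 C * c12 C ^+ 2 = 0 /\
  c11 C = 0 /\ c01 C = 0 /\ c00 C <> 0.

Definition U30 C : Prop :=
  TLeib8 C /\ c34 C = 0 /\ c23 C = 0 /\ c24 C = 0 /\ c12 C <> 0 /\
  4 * c14 C * c12 C - 5 * c13 C ^+ 2 = 0 /\
  - 7 * c13 C ^+ 3 + 4 * c15 C * c12 C ^+ 2 = 0 /\
  c11 C = 0 /\ c01 C = 0 /\ c00 C = 0.

Definition U34 C : Prop :=
  TLeib8 C /\ c34 C = 0 /\ c23 C = 0 /\ c24 C = 0 /\ c12 C = 0 /\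
  c13 C <> 0 /\ c14 C = 0 /\ c11 C = 0 /\ c01 C = 0 /\ c00 C <> 0.

Definition U35 C : Prop :=
  TLeib8 C /\ c34 C = 0 /\ c23 C = 0 /\ c24 C = 0 /\ c12 C = 0 /\
  c13 C <> 0 /\ c14 C = 0 /\ c11 C = 0 /\ c01 C = 0 /\ c00 C = 0.

Definition U38 C : Prop :=
  TLeib8 C /\ c34 C = 0 /\ c23 C = 0 /\ c24 C = 0 /\ c12 C = 0 /\
  c13 C = 0 /\ c11 C <> 0 /\ c15 C = 0 /\ c14 C = 0 /\
  4 * c00 C * c11 C - c01 C ^+ 2 <> 0.

Definition U39 C : Prop :=
  TLeib8 C /\ c34 C = 0 /\ c23 C = 0 /\ c24 C = 0 /\ c12 C = 0 /\
  c13 C = 0 /\ c11 C <> 0 /\ c15 C = 0 /\ c14 C = 0 /\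
  4 * c00 C * c11 C - c01 C ^+ 2 = 0.

Definition U41 C : Prop :=
  TLeib8 C /\ c34 C = 0 /\ c23 C = 0 /\ c24 C = 0 /\ c12 C = 0 /\
  c13 C = 0 /\ c11 C = 0 /\ c01 C <> 0 /\ c15 C = 0 /\ c14 C <> 0.

Definition U42 C : Prop :=
  TLeib8 C /\ c34 C = 0 /\ c23 C = 0 /\ c24 C = 0 /\ c12 C = 0 /\
  c13 C = 0 /\ c11 C = 0 /\ c01 C <> 0 /\ c15 C = 0 /\ c14 C = 0.

Definition U44 C : Prop :=
  TLeib8 C /\ c34 C = 0 /\ c23 C = 0 /\ c24 C = 0 /\ c12 C = 0 /\
  c13 C = 0 /\ c11 C = 0 /\ c01 C = 0 /\ c14 C <> 0 /\ c15 C = 0 /\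
  c00 C <> 0.

Definition U45 C : Prop :=
  TLeib8 C /\ c34 C = 0 /\ c23 C = 0 /\ c24 C = 0 /\ c12 C = 0 /\
  c13 C = 0 /\ c11 C = 0 /\ c01 C = 0 /\ c14 C <> 0 /\ c15 C = 0 /\
  c00 C = 0.

Definition U46 C : Prop :=
  TLeib8 C /\ c34 C = 0 /\ c23 C = 0 /\ c24 C = 0 /\ c12 C = 0 /\
  c13 C = 0 /\ c11 C = 0 /\ c01 C = 0 /\ c14 C = 0 /\ c15 C <> 0 /\
  c00 C <> 0.

Definition U47 C : Prop :=
  TLeib8 C /\ c34 C = 0 /\ c23 C = 0 /\ c24 C = 0 /\ c12 C = 0 /\
  c13 C = 0 /\ c11 C = 0 /\ c01 C = 0 /\ c14 C = 0 /\ c15 C <> 0 /\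
  c00 C = 0.

Definition U48 C : Prop :=
  TLeib8 C /\ c34 C = 0 /\ c23 C = 0 /\ c24 C = 0 /\ c12 C = 0 /\
  c13 C = 0 /\ c11 C = 0 /\ c01 C = 0 /\ c14 C = 0 /\ c15 C = 0 /\
  c00 C <> 0.

Definition U49 C : Prop :=
  TLeib8 C /\ c34 C = 0 /\ c23 C = 0 /\ c24 C = 0 /\ c12 C = 0 /\
  c13 C = 0 /\ c11 C = 0 /\ c01 C = 0 /\ c14 C = 0 /\ c15 C = 0 /\
  c00 C = 0.

End Subsets.

(* Main.v *)
Require Import Defs.
From HB Require Import structures.
From mathcomp Require Import all_boot all_order all_algebra.
From mathcomp Require Import ring.

Set Implicit Arguments.
Unset Strict Implicit.
Unset Printing Implicit Defensive.

Import GRing.Theory Num.Theory.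

Local Open Scope ring_scope.
Local Open Scope complex_scope.

(** Since [e_k, e_0] = e_(k+1) for 1 <= k <= 6, an isomorphism f from L(C) to
    L(D) is determined by x = f(e_0) and y = f(e_1): the other basis vectors go
    to v_(k+1) = [v_k, x], starting from v_1 = y.  Conversely, right
    multiplication by x is a derivation of the Leibniz algebra L(D), through
    which the three brackets [v_1, v_2], [v_2, v_3], [v_3, v_4] determine all
    brackets [v_i, v_j] with i, j >= 1 other than [v_1, v_1].  So, if some
    leading coefficients are nonzero, x and y define an isomorphism as soon as
    these three brackets, and [x, x], [x, y], [y, y], have the values
    prescribed by C ([adapted_iso], [iso_adapted]).  In coordinates this is a
    triangular system of ten equations, one for each parameter of C.

    The system shows that the sets are closed under isomorphism.  The
    symmetrized product is a quadratic form in the coordinates on e_0 and e_1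
    with values in the line of e_7, so (c00, c01, c11) transforms like such a
    form; the other parameters are coefficients of leading terms for the
    filtration by the spans of e_k, ..., e_7.  Hence each of them is multiplied
    by a nonzero scalar, provided that suitable earlier ones vanish
    ([iso_vanishing]), and the sets are defined by the vanishing or not of
    successive parameters.  The sets U29 and U30 also involve two polynomial
    relations, which come from the inversion of a quadratic power series
    ([iso_c12_catalan]).

    For transitivity, it is enough to reach every member of a set from its
    representative D.  The substitutions x = x0 e_0 + x1 e_1 and
    y = y1 e_1 + y3 e_3 + y4 e_4 + y5 e_5 in L(D) suffice: the parameters that a
    set leaves free are reached one after the other through x1, y3, y4, y5, each
    the solution of an affine equation, and the nonzero ones through the scales
    x0, y1 (and x0 + x1 when c34 is not 0), where at most one root has to be
    extracted. *)

(** * Products in coordinates *)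

Section Algebra.
Variable K : fieldType.
Implicit Types C D : params K.

Definition vec8 (a0 a1 a2 a3 a4 a5 a6 a7 : K) : 'rV[K]_8 :=
  \row_(i < 8) [:: a0; a1; a2; a3; a4; a5; a6; a7]`_i.

Lemma ord8_ind (P : 'I_8 -> Prop) :
  P (inord 0) -> P (inord 1) -> P (inord 2) -> P (inord 3) ->
  P (inord 4) -> P (inord 5) -> P (inord 6) -> P (inord 7) -> forall k, P k.
Proof.
move=> P0 P1 P2 P3 P4 P5 P6 P7 k; rewrite -(inord_val k).
by case: k => [[|[|[|[|[|[|[|[|k]]]]]]]] //].
Qed.

Lemma vec8_eta (x : 'rV[K]_8) :
  x = vec8 (x 0 (inord 0)) (x 0 (inord 1)) (x 0 (inord 2)) (x 0 (inord 3))
           (x 0 (inord 4)) (x 0 (inord 5)) (x 0 (inord 6)) (x 0 (inord 7)).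
Proof. by apply/rowP; apply: ord8_ind; rewrite mxE inordK. Qed.

Lemma vec8D a0 a1 a2 a3 a4 a5 a6 a7 b0 b1 b2 b3 b4 b5 b6 b7 :
  vec8 a0 a1 a2 a3 a4 a5 a6 a7 + vec8 b0 b1 b2 b3 b4 b5 b6 b7 =
  vec8 (a0 + b0) (a1 + b1) (a2 + b2) (a3 + b3)
       (a4 + b4) (a5 + b5) (a6 + b6) (a7 + b7).
Proof. by apply/rowP; apply: ord8_ind; rewrite !mxE inordK. Qed.

Lemma vec8Z k a0 a1 a2 a3 a4 a5 a6 a7 :
  k *: vec8 a0 a1 a2 a3 a4 a5 a6 a7 =
  vec8 (k * a0) (k * a1) (k * a2) (k * a3) (k * a4) (k * a5) (k * a6) (k * a7).
Proof. by apply/rowP; apply: ord8_ind; rewrite !mxE inordK. Qed.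

Lemma vec8N a0 a1 a2 a3 a4 a5 a6 a7 :
  - vec8 a0 a1 a2 a3 a4 a5 a6 a7 =
  vec8 (- a0) (- a1) (- a2) (- a3) (- a4) (- a5) (- a6) (- a7).
Proof. by apply/rowP; apply: ord8_ind; rewrite !mxE inordK. Qed.

Lemma vec80 : 0 = vec8 0 0 0 0 0 0 0 0.
Proof. by apply/rowP; apply: ord8_ind; rewrite !mxE inordK. Qed.

Lemma vec8_inj a0 a1 a2 a3 a4 a5 a6 a7 b0 b1 b2 b3 b4 b5 b6 b7 :
  vec8 a0 a1 a2 a3 a4 a5 a6 a7 = vec8 b0 b1 b2 b3 b4 b5 b6 b7 ->
  ((a0 = b0 /\ a1 = b1) /\ (a2 = b2 /\ a3 = b3)) /\
  ((a4 = b4 /\ a5 = b5) /\ (a6 = b6 /\ a7 = b7)).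
Proof.
move=> /rowP E.
move: (E (inord 0)) (E (inord 1)) (E (inord 2)) (E (inord 3)) (E (inord 4))
  (E (inord 5)) (E (inord 6)) (E (inord 7)).
by rewrite !mxE !inordK.
Qed.

Lemma e_vec8 k : (k < 8)%N ->
  e K k = vec8 (k == 0)%:R (k == 1)%:R (k == 2)%:R (k == 3)%:R
               (k == 4)%:R (k == 5)%:R (k == 6)%:R (k == 7)%:R.
Proof.
case: k => [|[|[|[|[|[|[|[|k]]]]]]]] // _; apply/rowP; apply: ord8_ind.
all: rewrite mxE mxE eqxx -val_eqE /= !inordK //.
Qed.

Lemma L_vec8 C x0 x1 x2 x3 x4 x5 x6 x7 y0 y1 y2 y3 y4 y5 y6 y7 :
  L C (vec8 x0 x1 x2 x3 x4 x5 x6 x7) (vec8 y0 y1 y2 y3 y4 y5 y6 y7) =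
  vec8 0 0 (x1 * y0 - x0 * y1) (x2 * y0 - x0 * y2)
   (x3 * y0 - x0 * y3 + c12 C * (x1 * y2 - x2 * y1))
   (x4 * y0 - x0 * y4 + c12 C * (x1 * y3 - x3 * y1)
      + c13 C * (x1 * y2 - x2 * y1))
   (x5 * y0 - x0 * y5 + (c12 C - c23 C) * (x1 * y4 - x4 * y1)
      + c13 C * (x1 * y3 - x3 * y1) + c14 C * (x1 * y2 - x2 * y1)
      + c23 C * (x2 * y3 - x3 * y2))
   (x6 * y0 - x0 * y6 + (c12 C - 2 * c23 C) * (x1 * y5 - x5 * y1)
      + (c13 C - c24 C) * (x1 * y4 - x4 * y1)
      + c14 C * (x1 * y3 - x3 * y1) + c15 C * (x1 * y2 - x2 * y1)
      + c23 C * (x2 * y4 - x4 * y2) + c24 C * (x2 * y3 - x3 * y2)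
      + c34 C * ((x2 * y5 - x5 * y2) - (x1 * y6 - x6 * y1)
                 - (x3 * y4 - x4 * y3))
      + c00 C * (x0 * y0) + c01 C * (x0 * y1) + c11 C * (x1 * y1)).
Proof.
rewrite /L !big_ord_recl !big_ord0 !mxE /= !e_vec8 //=.
rewrite vec80 !(vec8N, vec8Z, vec8D).
by congr vec8; rewrite /=; ring.
Qed.

Implicit Types (x y z u w : 'rV[K]_8).

Lemma LDl C x y z : L C (x + y) z = L C x z + L C y z.
Proof.
rewrite (vec8_eta x) (vec8_eta y) (vec8_eta z) vec8D !L_vec8 vec8D.
by congr vec8; ring.
Qed.

Lemma LDr C x y z : L C x (y + z) = L C x y + L C x z.
Proof.
rewrite (vec8_eta x) (vec8_eta y) (vec8_eta z) vec8D !L_vec8 vec8D.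
by congr vec8; ring.
Qed.

Lemma LZl C a x y : L C (a *: x) y = a *: L C x y.
Proof.
rewrite (vec8_eta x) (vec8_eta y) vec8Z !L_vec8 vec8Z.
by congr vec8; ring.
Qed.

Lemma LZr C a x y : L C x (a *: y) = a *: L C x y.
Proof.
rewrite (vec8_eta x) (vec8_eta y) vec8Z !L_vec8 vec8Z.
by congr vec8; ring.
Qed.

(** The failure of the Leibniz identity is a multiple of
    c34 (c23 + 2 c12) in the direction of e_7. *)
Lemma leibniz C x y z : TLeib8 C ->
  L C x (L C y z) = L C (L C x y) z - L C (L C x z) y.
Proof.
rewrite /TLeib8 => TC.
have c34c23 : c34 C * c23 C = - (2 * (c34 C * c12 C)).
  by apply/eqP; rewrite -addr_eq0; apply/eqP; rewrite -TC; ring.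
rewrite (vec8_eta x) (vec8_eta y) (vec8_eta z) !L_vec8 vec8N vec8D.
by congr vec8; ring: c34c23.
Qed.

Lemma L_suml D (I : finType) (F : I -> 'rV[K]_8) w :
  L D (\sum_i F i) w = \sum_i L D (F i) w.
Proof.
apply: (big_morph (L D ^~ w) (fun u1 u2 => LDl D u1 u2 w)).
by rewrite /= -(scale0r w) LZl !scale0r.
Qed.

Lemma L_sumr D (I : finType) (F : I -> 'rV[K]_8) u :
  L D u (\sum_i F i) = \sum_i L D u (F i).
Proof.
apply: (big_morph (L D u) (LDr D u)).
by rewrite -(scale0r u) LZr !scale0r.
Qed.

Lemma L_anticomm D u w :
  u 0 (inord 0) = 0 -> u 0 (inord 1) = 0 -> L D w u = - L D u w.
Proof.
move=> u0 u1; rewrite (vec8_eta u) (vec8_eta w) u0 u1 !L_vec8 vec8N.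
by congr vec8; ring.
Qed.

Lemma L_alt D u :
  u 0 (inord 0) = 0 -> u 0 (inord 1) = 0 -> L D u u = 0.
Proof.
move=> u0 u1; rewrite (vec8_eta u) u0 u1 !L_vec8 vec80.
by congr vec8; ring.
Qed.

(** * Isomorphisms as pairs of generators *)

(** The only candidates for the images of e_0, e_1, ..., e_7 under a morphism
    that sends e_0 to x and e_1 to y. *)
Definition chain D x y k := if k is j.+1 then iter j (L D ^~ x) y else x.

(** Enough of the relations of L(C) between the vectors [chain D x y k] of L(D)
    to imply the others; the conditions on the coordinates of x and y say that
    these vectors form a triangular basis. *)
Definition adapted C D x y :=
  let v := chain D x y in
  [/\ [/\ y 0 (inord 0) = 0, y 0 (inord 1) != 0, x 0 (inord 0) != 0
        & x 0 (inord 0) + c34 D * x 0 (inord 1) != 0],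
      [/\ L D x x = c00 C *: v 7, L D x y = - v 2 + c01 C *: v 7
        & L D y y = c11 C *: v 7]
    & [/\ L D y (v 2) =
            c12 C *: v 4 + c13 C *: v 5 + c14 C *: v 6 + c15 C *: v 7,
          L D (v 2) (v 3) = c23 C *: v 6 + c24 C *: v 7
        & L D (v 3) (v 4) = - c34 C *: v 7]].

(** The iterates go down the filtration by the spans of e_k, ..., e_7, and their
    two leading coefficients depend only on the coordinates of x and y on e_0,
    e_1 and e_2.  These suffice to read off the leading terms of the
    relations. *)
Lemma chain_shape D x y (x0 := x 0 (inord 0)) (x1 := x 0 (inord 1))
    (y0 := y 0 (inord 0)) (y1 := y 0 (inord 1))
    (v := chain D x y) (d := x0 * y1 - x1 * y0)
    (p := x0 * y 0 (inord 2) - x 0 (inord 2) * y0)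
    (s6 := x0 ^+ 3 * p - (3 * c12 D - c23 D) * (x0 ^+ 2 * x1 * d)) :
  [/\ exists p4 p5 p6 p7, v 2 = vec8 0 0 d p p4 p5 p6 p7,
      exists q5 q6 q7,
        v 3 = vec8 0 0 0 (x0 * d) (x0 * p - c12 D * (x1 * d)) q5 q6 q7,
      exists r6 r7, v 4 = vec8 0 0 0 0 (x0 ^+ 2 * d)
        (x0 ^+ 2 * p - 2 * c12 D * (x0 * x1 * d)) r6 r7 &
  [/\ exists s7, v 5 = vec8 0 0 0 0 0 (x0 ^+ 3 * d) s6 s7,
      v 6 = vec8 0 0 0 0 0 0 (x0 ^+ 4 * d)
        ((x0 + c34 D * x1) * s6 - (c12 D - 2 * c23 D) * (x0 ^+ 3 * x1 * d)
           - c34 D * (x0 ^+ 3 * x 0 (inord 2) * d)) &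
      v 7 = vec8 0 0 0 0 0 0 0 (x0 ^+ 4 * d * (x0 + c34 D * x1))]].
Proof.
have Ex : x = vec8 x0 x1 _ _ _ _ _ _ := vec8_eta x.
have v1 : v 1 = vec8 y0 y1 _ _ _ _ _ _ := vec8_eta y.
have vS k : v k.+2 = L D (v k.+1) x by [].
have [p4 [p5 [p6 [p7 Ep]]]] : exists p4 p5 p6 p7,
    v 2 = vec8 0 0 d p p4 p5 p6 p7.
  do 4! eexists; rewrite vS v1 [X in L D _ X]Ex L_vec8.
  by congr vec8; rewrite /d /p; ring.
have [q5 [q6 [q7 Eq]]] : exists q5 q6 q7,
    v 3 = vec8 0 0 0 (x0 * d) (x0 * p - c12 D * (x1 * d)) q5 q6 q7.
  by do 3! eexists; rewrite vS Ep [X in L D _ X]Ex L_vec8; congr vec8; ring.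
have [r6 [r7 Er]] : exists r6 r7,
    v 4 = vec8 0 0 0 0 (x0 ^+ 2 * d)
      (x0 ^+ 2 * p - 2 * c12 D * (x0 * x1 * d)) r6 r7.
  by do 2! eexists; rewrite vS Eq [X in L D _ X]Ex L_vec8; congr vec8; ring.
have [s7 Es] : exists s7, v 5 = vec8 0 0 0 0 0 (x0 ^+ 3 * d) s6 s7.
  by eexists; rewrite vS Er [X in L D _ X]Ex L_vec8 /s6; congr vec8; ring.
have Et : v 6 = vec8 0 0 0 0 0 0 (x0 ^+ 4 * d)
    ((x0 + c34 D * x1) * s6 - (c12 D - 2 * c23 D) * (x0 ^+ 3 * x1 * d)
           - c34 D * (x0 ^+ 3 * x 0 (inord 2) * d)).
  by rewrite vS Es [X in L D _ X]Ex L_vec8; congr vec8; ring.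
have El : v 7 = vec8 0 0 0 0 0 0 0 (x0 ^+ 4 * d * (x0 + c34 D * x1)).
  by rewrite vS Et [X in L D _ X]Ex L_vec8; congr vec8; ring.
split; [by do 4! eexists; exact: Ep | by do 3! eexists; exact: Eq
       | by do 2! eexists; exact: Er | split=> //].
by exists s7.
Qed.

Definition frame D x y : 'M[K]_8 := \matrix_(k < 8) chain D x y k.

Lemma e_frame D x y k : (k < 8)%N -> e K k *m frame D x y = chain D x y k.
Proof. by move=> k8; rewrite -rowE rowK inordK. Qed.

Lemma frame_multiplicative C D x y :
  (forall i j, (i < 8)%N -> (j < 8)%N ->
     bracket C i j *m frame D x y = L D (chain D x y i) (chain D x y j)) ->
  forall u w,
    L C u w *m frame D x y = L D (u *m frame D x y) (w *m frame D x y).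
Proof.
move=> tbl u w.
have frameE z : z *m frame D x y = \sum_i z 0 i *: chain D x y i.
  by rewrite mulmx_sum_row; apply: eq_bigr => i _; rewrite rowK.
rewrite (frameE u) (frameE w) L_suml [L C u w]/L mulmx_suml.
apply: eq_bigr => i _; rewrite LZl L_sumr mulmx_suml scaler_sumr.
apply: eq_bigr => j _.
by rewrite LZr scalerA -scalemxAl tbl.
Qed.

(** Beyond the relations assumed in [adapted], the table follows by applying the
    derivation [., x] to them repeatedly ([der] below), by antisymmetry of the
    products of iterates of index at least 2, and by the filtration for indices
    of sum greater than 7. *)
Lemma adapted_table C D x y : TLeib8 D -> adapted C D x y ->
  forall i j, (i < 8)%N -> (j < 8)%N ->
     bracket C i j *m frame D x y = L D (chain D x y i) (chain D x y j).
Proof.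
move=> TD -[[y00 _ _ _]].
have := chain_shape D x y; cbv zeta.
set v := chain D x y.
move=> [[p4 [p5 [p6 [p7 E2]]]] [q5 [q6 [q7 E3]]] [r6 [r7 E4]]].
move=> [[s7 E5] E6 E7].
move=> [R00 R01 R11] [R12 R23 R34].
have v0 : v 0 = x by [].
have v1 : v 1 = y by [].
have vS k : (0 < k)%N -> L D (v k) x = v k.+1 by case: k.
have v8 : v 8 = 0.
  by rewrite -vS // E7 (vec8_eta x) L_vec8 vec80; congr vec8; ring.
have Z2 k : (1 < k < 8)%N -> v k 0 (inord 0) = 0 /\ v k 0 (inord 1) = 0.
  case: k => [|[|[|[|[|[|[|[|k]]]]]]]] // _;
  by rewrite ?E2 ?E3 ?E4 ?E5 ?E6 ?E7 !mxE !inordK.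
have anti i w : (1 < i < 8)%N -> L D (v i) w = - L D w (v i).
  by move=> /Z2[vi0 vi1]; rewrite [L D w _]L_anticomm // opprK.
have alt i : (1 < i < 8)%N -> L D (v i) (v i) = 0.
  by move=> /Z2[]; apply: L_alt.
have der i j : (0 < i)%N -> (0 < j)%N ->
    L D (v i) (v j.+1) = L D (L D (v i) (v j)) x - L D (v i.+1) (v j).
  by move=> i0 j0; rewrite -(vS j) // leibniz // vS.
have R13 : L D y (v 3) = c12 C *: v 5 + c13 C *: v 6 + c14 C *: v 7.
  by rewrite -v1 der // v1 R12 alt // !LDl !LZl !vS // v8 scaler0 !addr0 subr0.
have R14 : L D y (v 4) = (c12 C - c23 C) *: v 6 + (c13 C - c24 C) *: v 7.
  rewrite -v1 der // v1 R13 R23 // !LDl !LZl !vS // v8 scaler0 !addr0.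
  by rewrite opprD addrACA -!scalerBl.
have R24 : L D (v 2) (v 4) = c23 C *: v 7.
  by rewrite der // R23 alt // !LDl !LZl !vS // v8 scaler0 !addr0 subr0.
have R15 : L D y (v 5) = (c12 C - 2 * c23 C) *: v 7.
  rewrite -v1 der // v1 R14 R24 // !LDl !LZl !vS // v8 scaler0 !addr0.
  by rewrite -scalerBl -addrA -opprD -[2]/(1 + 1) mulrDl !mul1r.
have R25 : L D (v 2) (v 5) = c34 C *: v 7.
  rewrite der // R24 R34 // !LZl !vS // v8 scaler0 sub0r.
  by rewrite scaleNr opprK.
have R16 : L D y (v 6) = - c34 C *: v 7.
  by rewrite -v1 der // v1 R15 R25 // !LZl !vS // v8 scaler0 sub0r scaleNr.
have far i j : (i < 8)%N -> (j < 8)%N -> (0 < i)%N -> (0 < j)%N ->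
    (7 < i + j)%N -> L D (v i) (v j) = 0.
  case: i => [|[|[|[|[|[|[|[|i]]]]]]]] //;
  case: j => [|[|[|[|[|[|[|[|j]]]]]]]] // _ _ _ _ _;
  rewrite ?v1 1?(vec8_eta y) ?y00 ?E2 ?E3 ?E4 ?E5 ?E6 ?E7 L_vec8 vec80;
  by congr vec8; ring.
have eM k : (k < 8)%N -> e K k *m frame D x y = v k by exact: e_frame.
(* From here on only the relations are used: [v] must not unfold. *)
move: eM; rewrite -/v; set M := frame D x y => eM; clearbody v M.
have up i : (1 < i < 8)%N -> L D x (v i) = - v i.+1.
  by move=> i28; rewrite -vS ?anti ?opprK //; case/andP: i28 => /ltnW.
case=> [|[|[|[|[|[|[|[|i]]]]]]]] // [|[|[|[|[|[|[|[|j]]]]]]]] // _ _.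
all: rewrite /bracket /= ?mulNmx ?mulmxDl -?scalemxAl ?mulNmx ?mul0mx ?eM //.
all: rewrite ?(exprS, expr0, mulNr, mul1r, mulr1, opprK).
all: try by [rewrite far | rewrite alt].
all: rewrite ?v0 ?R00 ?vS ?v8 ?v1 ?R01 ?R11 //.
all: rewrite ?R12 ?R13 ?R14 ?R15 ?R16 ?R23 ?R24 ?R25 ?R34 //.
all: try by rewrite up ?v8 ?oppr0.
all: try by rewrite anti ?R12 ?R13 ?R14 ?R15 ?R16 ?R23 ?R24 ?R25 ?R34
  ?scaleNr ?opprK.
Qed.

Lemma adapted_iso C D x y : TLeib8 D -> adapted C D x y -> L_isomorphic C D.
Proof.
move=> TD Axy; have tbl := adapted_table TD Axy.
case: Axy => [[y00 y01 x00 xl] _ _].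
set M := frame D x y in tbl.
have Mu : M \in unitmx.
  have := chain_shape D x y; cbv zeta; rewrite y00 !mulr0 !subr0.
  set v := chain D x y.
  move=> [[p4 [p5 [p6 [p7 E2]]]] [q5 [q6 [q7 E3]]] [r6 [r7 E4]]].
  move=> [[s7 E5] E6 E7].
  have tri i j : (j < 8)%N -> (i < j)%N -> v j 0 (inord i) = 0.
    case: j => [|[|[|[|[|[|[|[|j]]]]]]]] //;
    case: i => [|[|[|[|[|[|[|[|i]]]]]]]] // _ _;
    by rewrite ?E2 ?E3 ?E4 ?E5 ?E6 ?E7 // ?mxE ?inordK.
  have diag k : (k < 8)%N -> v k 0 (inord k) != 0.
    case: k => [|[|[|[|[|[|[|[|k]]]]]]]] // _;
    by rewrite ?E2 ?E3 ?E4 ?E5 ?E6 ?E7 // ?mxE ?inordK //= ?mulf_neq0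
               ?expf_neq0.
  rewrite -unitmx_tr unitmxE det_trig ?unitfE.
    apply/prodf_neq0 => i _; rewrite !mxE.
    by have := diag i (ltn_ord i); rewrite inord_val.
  apply/is_trig_mxP => i j ij; rewrite !mxE.
  by have := tri i j (ltn_ord j) ij; rewrite inord_val.
exists (mulmxr M); split.
  by exists (mulmx ^~ (invmx M)) => u /=; rewrite ?mulmxK ?mulmxKV.
exact: frame_multiplicative.
Qed.

Lemma L_e C i j : (i < 8)%N -> (j < 8)%N -> L C (e K i) (e K j) = bracket C i j.
Proof.
move=> i8 j8; rewrite /L (bigD1 (inord i)) //= (bigD1 (inord j)) //=.
rewrite !mxE !eqxx !inordK // mulr1 scale1r.
rewrite !big1 ?addr0 // => [k kNi|k kNj].
  by apply: big1 => l _; rewrite !mxE (negPf kNi) mul0r scale0r.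
by rewrite !mxE (negPf kNj) mulr0 scale0r.
Qed.

(** The subspace of [y 0 (inord 0) = 0] is preserved by isomorphisms because it
    consists of the z such that [., z] maps the span of e_2, ..., e_7 into that
    of e_4, ..., e_7. *)
Lemma iso_adapted C D : L_isomorphic C D -> exists x y, adapted C D x y.
Proof.
case=> f [/bij_inj finj fM].
exists (f (e K 0)), (f (e K 1)).
have fL i j : (i < 8)%N -> (j < 8)%N ->
  L D (f (e K i)) (f (e K j)) = f (bracket C i j).
  by move=> i8 j8; rewrite -fM L_e.
have chE k : (k < 8)%N -> chain D (f (e K 0)) (f (e K 1)) k = f (e K k).
  case: k => // k; elim: k => // k IH k8.
  rewrite [LHS]/= -/(chain D (f (e K 0)) (f (e K 1)) k.+1) IH ?fL // 1?ltnW //.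
  by case: k k8 {IH} => [|[|[|[|[|[|k]]]]]].
have v7N0 : f (e K 7) != 0.
  rewrite -[0](linear0 f) (inj_eq finj) e_vec8 // vec80.
  by apply/eqP => /vec8_inj[_ [_ [_ /eqP]]]; rewrite oner_eq0.
have := chain_shape D (f (e K 0)) (f (e K 1)); cbv zeta.
set x0 := f (e K 0) 0 (inord 0); set x1 := f (e K 0) 0 (inord 1).
set y0 := f (e K 1) 0 (inord 0); set y1 := f (e K 1) 0 (inord 1).
set d := x0 * y1 - x1 * y0; rewrite !chE //.
move=> [[p4 [p5 [p6 [p7 E2]]]] _ [r6 [r7 E4]]].
move=> [[s7 E5] E6 E7].
have lN0 : x0 ^+ 4 * d * (x0 + c34 D * x1) != 0.
  by apply: contraNneq v7N0 => l0; rewrite E7 l0 -vec80.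
have x0N0 : x0 != 0.
  by apply: contraNneq lN0 => ->; rewrite expr0n /= !mul0r.
have dN0 : d != 0 by apply: contraNneq lN0 => ->; rewrite mulr0 mul0r.
have xlN0 : x0 + c34 D * x1 != 0.
  by apply: contraNneq lN0 => ->; rewrite mulr0.
(* Compare the coordinates on e_3 in the image of [e_2, e_1]. *)
have y0E : y0 = 0.
  have := fL 2%N 1%N isT isT; rewrite /bracket linearN !linearD !linearZ /=.
  rewrite E4 E5 E6 E7 E2 [X in L D _ X]vec8_eta L_vec8 !(vec8N, vec8Z, vec8D).
  move=> /vec8_inj[[_ [_ E]] _]; apply/eqP; move/eqP: E; rewrite -/y0.
  rewrite !(mul0r, mulr0, subr0, addr0, oppr0) mulf_eq0 => /orP[/eqP d0|//].
  by rewrite d0 eqxx in dN0.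
rewrite /adapted !chE // -/x0 -/x1 -/y0 -/y1.
split.
- split=> //; move: dN0; rewrite /d y0E mulr0 subr0.
  by rewrite mulf_eq0 negb_or => /andP[].
- rewrite !fL //= linearD linearN !linearZ.
  by split.
- rewrite !fL //= !linearD !linearZ.
  by rewrite -signr_odd /= expr1 mulN1r.
Qed.

(** * Invariants *)

(** Solves the equation c = d for an unknown a that has coefficient k in it. *)
Lemma eq_by_combination (k a b c d : K) :
  c = d -> k != 0 -> k * (a - b) = c - d -> a = b.
Proof.
move=> -> k0 /eqP; rewrite subrr mulf_eq0 (negPf k0) subr_eq0 /=.
by move/eqP.
Qed.

(** The leading terms of the ten equations.  Here x0, x1 are the coordinates of
    the image of e_0 on e_0 and e_1, and y1 that of the image of e_1 on e_1; the
    image of e_7 is l times e_7. *)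
Lemma iso_invariants C D : L_isomorphic C D ->
  exists x0 x1 y1 : K, let l := x0 ^+ 5 * y1 * (x0 + c34 D * x1) in
  [/\ [/\ x0 != 0, y1 != 0 & l != 0],
      [/\ c00 C * l = c00 D * x0 ^+ 2 + c01 D * (x0 * x1) + c11 D * x1 ^+ 2,
          c01 C * l = c01 D * (x0 * y1) + 2 * c11 D * (x1 * y1)
        & c11 C * l = c11 D * y1 ^+ 2],
      [/\ c12 C * x0 ^+ 2 = c12 D * y1,
          c13 C * x0 ^+ 4 = y1 * (c13 D * x0 + 2 * c12 D ^+ 2 * x1),
          c23 C * x0 ^+ 2 = c23 D * y1
        & c34 C * (x0 + c34 D * x1) = c34 D * y1]
    & [/\ c12 D = 0 -> c23 D = 0 -> c14 C * x0 ^+ 4 = c14 D * y1,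
          c23 D = 0 -> c34 D = 0 -> c24 C * x0 ^+ 3 = c24 D * y1
        & c12 D = 0 -> c13 D = 0 -> c23 D = 0 -> c24 D = 0 -> c34 D = 0 ->
          c15 C * x0 ^+ 5 = c15 D * y1]].
Proof.
case/iso_adapted=> x [y [[y00 y1N0 x0N0 xlN0]]].
have := chain_shape D x y; cbv zeta; rewrite y00 !mulr0 !subr0.
set v := chain D x y.
move=> [[p4 [p5 [p6 [p7 E2]]]] [q5 [q6 [q7 E3]]] [r6 [r7 E4]]] [[s7 E5] E6 E7].
case=> R00 R01 R11 [R12 R23 R34].
have R10 : L D y x = v 2 by [].
have Ex := vec8_eta x; have := vec8_eta y; rewrite y00 => Ey.
move: Ex Ey x0N0 xlN0 y1N0 R10 R00 R01 R11 R12 R23 R34.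
rewrite {}E2 {}E3 {}E4 {}E5 {}E6 {}E7 {}/v {y00}.
move: (x 0 (inord 0)) (x 0 (inord 1)) (x 0 (inord 2)) (x 0 (inord 3))
  (x 0 (inord 4)) (x 0 (inord 5)) (x 0 (inord 6)) (x 0 (inord 7))
  => x0 x1 x2 x3 x4 x5 x6 x7.
move: (y 0 (inord 1)) (y 0 (inord 2)) (y 0 (inord 3)) (y 0 (inord 4))
  (y 0 (inord 5)) (y 0 (inord 6)) (y 0 (inord 7)) => y1 y2 y3 y4 y5 y6 y7.
move=> -> -> x0N0 xlN0 y1N0.
rewrite !L_vec8 !(vec8Z, vec8N, vec8D).
move=> /vec8_inj[_ [_ [_ R10]]] /vec8_inj[_ [_ [_ R00]]].
move=> /vec8_inj[_ [_ [_ R01]]] /vec8_inj[_ [_ [_ R11]]].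
move=> /vec8_inj[_ [[R124 R125] [R126 R127]]] /vec8_inj[_ [_ [R236 R237]]].
move=> /vec8_inj[_ [_ [_ R34]]].
exists x0, x1, y1; cbv zeta.
have lN0 : x0 ^+ 5 * y1 * (x0 + c34 D * x1) != 0.
  by rewrite !mulf_neq0 ?expf_neq0.
have monN0 k : x0 ^+ k * y1 != 0 by rewrite mulf_neq0 ?expf_neq0.
have c12E : c12 C = c12 D * y1 / x0 ^+ 2.
  by apply: (eq_by_combination (esym R124) (monN0 3%N)); field.
have c13E : c13 C = y1 * (c13 D * x0 + 2 * c12 D ^+ 2 * x1) / x0 ^+ 4.
  by apply: (eq_by_combination (esym R125) (monN0 4%N)); rewrite c12E; field.
have c23E : c23 C = c23 D * y1 / x0 ^+ 2.
  by apply: (eq_by_combination (esym R236) (monN0 5%N)); field.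
have c14E : c12 D = 0 -> c23 D = 0 -> c14 C = c14 D * y1 / x0 ^+ 4.
  move=> D12 D23; apply: (eq_by_combination (esym R126) (monN0 5%N)).
  by rewrite c13E c12E D12 D23; field.
split=> //; split.
- by apply: (eq_by_combination (esym R00) (oner_neq0 _)); ring.
- (* The sum of the products in both orders is the polarized form. *)
  apply: (eq_by_combination (esym (congr2 +%R R01 R10)) (oner_neq0 _)).
  by ring.
- by apply: (eq_by_combination (esym R11) (oner_neq0 _)); ring.
- by rewrite c12E; field.
- by rewrite c13E; field.
- by rewrite c23E; field.
- by apply: (eq_by_combination R34 (monN0 5%N)); ring.
- by move=> D12 D23; rewrite c14E //; field.
- move=> D23 D34; apply: (eq_by_combination (esym R237) (monN0 3%N)).
  by rewrite c23E D23 D34; ring.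
- move=> D12 D13 D23 D24 D34.
  apply: (eq_by_combination (esym R127) (monN0 1%N)).
  by rewrite c14E // c13E c12E D12 D13 D23 D24 D34; field.
Qed.

Lemma vanish_iff (c k d m : K) :
  c * k = d * m -> k != 0 -> m != 0 -> c = 0 <-> d = 0.
Proof.
move=> E k0 m0; split=> E0; apply/eqP; move: E; rewrite E0 mul0r.
  by move/esym/eqP; rewrite mulf_eq0 (negPf m0) orbF.
by move/eqP; rewrite mulf_eq0 (negPf k0) orbF.
Qed.

(** For each parameter in turn, whether it vanishes is invariant once the
    parameters that could be mixed with it do.  This is the form in which the
    sets are defined.  The discriminant is that of the quadratic form. *)
Lemma iso_vanishing C D : L_isomorphic C D ->
  [/\ c34 C = 0 <-> c34 D = 0,
      c23 C = 0 <-> c23 D = 0,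
      c12 C = 0 <-> c12 D = 0,
      c11 C = 0 <-> c11 D = 0 &
  [/\ 4 * c00 C * c11 C - c01 C ^+ 2 = 0 <->
        4 * c00 D * c11 D - c01 D ^+ 2 = 0,
      c11 D = 0 -> c01 C = 0 <-> c01 D = 0,
      c11 D = 0 -> c01 D = 0 -> c00 C = 0 <-> c00 D = 0,
      c12 D = 0 -> c13 C = 0 <-> c13 D = 0 &
  [/\ c12 D = 0 -> c23 D = 0 -> c14 C = 0 <-> c14 D = 0,
      c23 D = 0 -> c34 D = 0 -> c24 C = 0 <-> c24 D = 0 &
      c12 D = 0 -> c13 D = 0 -> c23 D = 0 -> c24 D = 0 -> c34 D = 0 ->
      c15 C = 0 <-> c15 D = 0]]].
Proof.
case/iso_invariants=> x0 [x1 [y1]]; cbv zeta.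
set l := x0 ^+ 5 * y1 * (x0 + c34 D * x1).
move=> [[x0N0 y1N0 lN0] [E00 E01 E11] [E12 E13 E23 E34] [E14 E24 E15]].
have xlN0 : x0 + c34 D * x1 != 0.
  by apply: contraNneq lN0 => xl0; rewrite /l xl0 mulr0.
have xN0 k : x0 ^+ k != 0 by rewrite expf_neq0.
split; first exact: vanish_iff E34 xlN0 y1N0.
- exact: vanish_iff E23 (xN0 2) y1N0.
- exact: vanish_iff E12 (xN0 2) y1N0.
- by apply: vanish_iff E11 lN0 _; rewrite expf_neq0.
split.
- apply: (@vanish_iff _ (l ^+ 2) _ (x0 ^+ 2 * y1 ^+ 2));
    rewrite ?mulf_neq0 ?expf_neq0 //.
  transitivity (4 * (c00 C * l) * (c11 C * l) - (c01 C * l) ^+ 2).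
    by ring.
  by rewrite E00 E01 E11; ring.
- move=> D11; apply: vanish_iff lN0 (_ : x0 * y1 != 0); rewrite ?mulf_neq0 //.
  by rewrite E01 D11; ring.
- move=> D11 D01; apply: vanish_iff lN0 (xN0 2).
  by rewrite E00 D11 D01; ring.
- move=> D12.
  apply: vanish_iff (xN0 4) (_ : x0 * y1 != 0); rewrite ?mulf_neq0 //.
  by rewrite E13 D12; ring.
split.
- by move=> D12 D23; apply: vanish_iff (E14 D12 D23) (xN0 4) y1N0.
- by move=> D23 D34; apply: vanish_iff (E24 D23 D34) (xN0 3) y1N0.
- move=> D12 D13 D23 D24 D34.
  exact: vanish_iff (E15 D12 D13 D23 D24 D34) (xN0 5) y1N0.
Qed.

(** The numbers 2, 5, 14 in the proof are Catalan numbers.  On the span of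
    e_2, ..., e_7, let S be the shift e_k |-> e_(k+1); there the product by x on
    the right is T = x0 S - x1 S^2, and the product by y on the left is y1 S^2.
    Since v_k = T^(k-2) v_2, the relation for [v_1, v_2] says that
    y1 S^2 = c12 T^2 + c13 T^3 + c14 T^4 + c15 T^5 on v_2, hence on the whole
    span, as v_2 generates it under S.  So the c1k are the coefficients of
    y1 S^2 as a series in T, where S = T/x0 + x1 T^2/x0^3 + ... is the
    inverse series:
    the other coordinates of x and y do not enter. *)
Lemma iso_c12_catalan C (q00 q01 q11 : K) :
  L_isomorphic C (Params q00 q01 q11 1 0 0 0 0 0 0) ->
  4 * c14 C * c12 C = 5 * c13 C ^+ 2 /\
  7 * c13 C ^+ 3 = 4 * c15 C * c12 C ^+ 2.
Proof.
set D := Params _ _ _ _ _ _ _ _ _ _.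
case/iso_adapted=> x [y [[y00 y1N0 x0N0 _] _ [R12 _ _]]].
have := chain_shape D x y; cbv zeta; rewrite y00 !mulr0 !subr0.
have vS k : chain D x y k.+3 = L D (chain D x y k.+2) x by [].
move: (chain D x y) vS R12 => v vS R12.
move=> [[p4 [p5 [p6 [p7 E2]]]] _ _] _.
rewrite !vS E2 in R12.
have Ex := vec8_eta x; have := vec8_eta y; rewrite y00 => Ey.
move: Ex Ey R12 x0N0 y1N0; rewrite {E2 vS y00 v}.
move: (x 0 (inord 0)) (x 0 (inord 1)) (x 0 (inord 2)) (x 0 (inord 3))
  (x 0 (inord 4)) (x 0 (inord 5)) (x 0 (inord 6)) (x 0 (inord 7))
  => x0 x1 x2 x3 x4 x5 x6 x7.
move: (y 0 (inord 1)) (y 0 (inord 2)) (y 0 (inord 3)) (y 0 (inord 4))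
  (y 0 (inord 5)) (y 0 (inord 6)) (y 0 (inord 7)) => y1 y2 y3 y4 y5 y6 y7.
move=> -> ->; rewrite !L_vec8 !(vec8Z, vec8D) /=.
move=> /vec8_inj[_ [[R4 R5] [R6 R7]]] x0N0 y1N0.
have monN0 k : x0 ^+ k * y1 != 0 by rewrite mulf_neq0 ?expf_neq0.
have c12E : c12 C = y1 / x0 ^+ 2.
  by apply: (eq_by_combination (esym R4) (monN0 3%N)); field.
have c13E : c13 C = 2 * x1 * y1 / x0 ^+ 4.
  by apply: (eq_by_combination (esym R5) (monN0 4%N)); rewrite c12E; field.
have c14E : c14 C = 5 * x1 ^+ 2 * y1 / x0 ^+ 6.
  apply: (eq_by_combination (esym R6) (monN0 5%N)).
  by rewrite c12E c13E; field.
have c15E : c15 C = 14 * x1 ^+ 3 * y1 / x0 ^+ 8.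
  apply: (eq_by_combination (esym R7) (monN0 6%N)).
  by rewrite c12E c13E c14E; field.
by rewrite c12E c13E c14E c15E; split; field.
Qed.

End Algebra.

(** * Constructions *)

Section Constructions.
Variable K : numFieldType.
Implicit Types C D : params K.

(** The substitutions used below, with the iterates given by coordinates so that
    every premise is a computation. *)
Lemma adapted_coordinates C D (x0 x1 y1 y3 y4 y5 : K)
    (x := vec8 x0 x1 0 0 0 0 0 0) (y := vec8 0 y1 0 y3 y4 y5 0 0)
    (v2 v3 v4 v5 v6 v7 : 'rV[K]_8) :
  x0 != 0 -> y1 != 0 -> x0 + c34 D * x1 != 0 ->
  L D y x = v2 -> L D v2 x = v3 -> L D v3 x = v4 -> L D v4 x = v5 ->
  L D v5 x = v6 -> L D v6 x = v7 ->
  L D x x = c00 C *: v7 -> L D x y = - v2 + c01 C *: v7 ->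
  L D y y = c11 C *: v7 ->
  L D y v2 = c12 C *: v4 + c13 C *: v5 + c14 C *: v6 + c15 C *: v7 ->
  L D v2 v3 = c23 C *: v6 + c24 C *: v7 ->
  L D v3 v4 = - c34 C *: v7 ->
  adapted C D x y.
Proof.
move=> x00 y10 xl0 <- <- <- <- <- <- R00 R01 R11 R12 R23 R34.
by rewrite /adapted !mxE !inordK.
Qed.

(** The image of e_7 is scaled by x0^5 y1 (x0 + x1), so that there are three
    scales x0, y1 and x0 + x1 to normalize c00, c34 and one of c13, c14.  The
    values of c24 and c15 are reached by y3 and y5. *)
Lemma iso_c34 C (q a b x0 y1 : K) :
  c34 C != 0 -> c11 C = 0 -> c01 C = 0 -> c12 C = 0 -> c23 C = 0 ->
  x0 != 0 -> y1 != 0 -> c13 C * x0 ^+ 3 = a * y1 ->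
  c14 C * x0 ^+ 4 = b * y1 -> c00 C * (x0 ^+ 3 * y1 ^+ 2) = q * c34 C ->
  L_isomorphic C (Params q 0 0 0 a b 0 0 0 1).
Proof.
case: C => d00 d01 d11 d12 d13 d14 d15 d23 d24 d34 /= d34N0 -> -> -> ->.
move=> x0N0 y1N0 E13 E14 E00.
(* The equation c34 C (x0 + x1) = y1 determines x1. *)
pose x1 := y1 / d34 - x0.
have xlE : x0 + x1 = y1 / d34 by rewrite /x1; ring.
have xlN0 : x0 + x1 != 0 by rewrite xlE mulf_neq0 ?invr_eq0.
have {E00} <- : d00 * (x0 ^+ 3 * y1 * (x0 + x1)) = q.
  by apply: (mulIf d34N0); rewrite -E00 xlE; field.
have {xlE} -> : d34 = y1 / (x0 + x1).
  by rewrite xlE invf_div mulrC divfK.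
move: x1 xlN0 => x1 xlN0.
have {E13} -> : d13 = a * y1 / x0 ^+ 3 by rewrite -E13 mulfK ?expf_neq0.
have {E14} -> : d14 = b * y1 / x0 ^+ 4 by rewrite -E14 mulfK ?expf_neq0.
pose l := x0 ^+ 5 * y1 * (x0 + x1).
have n2 : (2 : K) != 0 by rewrite pnatr_eq0.
(* These are the coefficients of [v_2, v_3] and [v_1, v_2] on v_7. *)
have [y3 ->] : exists y3,
    d24 = (2 * x0 ^+ 3 * y1 * y3 - a * x1 * x0 ^+ 2 * y1 ^+ 2) / l.
  exists ((d24 * l + a * x0 ^+ 2 * x1 * y1 ^+ 2) / (2 * x0 ^+ 3 * y1)).
  by rewrite /l; field; rewrite ?xlN0 ?n2 ?x0N0 ?y1N0.
have [y5 ->] : exists y5, d15 = (- 2 * x0 * y1 * y5 - x0 * y3 ^+ 2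
    + a ^+ 2 * y1 ^+ 2 * x1 * (3 * x0 + 2 * x1) / x0) / l.
  exists ((- x0 * y3 ^+ 2
    + a ^+ 2 * y1 ^+ 2 * x1 * (3 * x0 + 2 * x1) / x0 - d15 * l)
    / (2 * x0 * y1)).
  by rewrite /l; field; rewrite ?xlN0 ?n2 ?x0N0 ?y1N0.
apply: (@adapted_iso _ _ _ (vec8 x0 x1 0 0 0 0 0 0) (vec8 0 y1 0 y3 0 y5 0 0)).
  by rewrite /TLeib8 /=; ring.
apply: adapted_coordinates; rewrite ?mul1r //; try by rewrite L_vec8 /=.
all: rewrite !L_vec8 /= ?vec8N ?vec8Z ?vec8D; congr vec8; rewrite /l.
all: by field; rewrite ?xlN0 ?n2 ?x0N0 ?y1N0.
Qed.

(** The values of c24, c14 and c15 are reached by x1, y3 and y4, in this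
    order. *)
Lemma iso_c23 C (q x0 y1 : K) :
  c34 C = 0 -> c11 C = 0 -> c01 C = 0 -> c12 C = 0 -> c13 C = 0 ->
  x0 != 0 -> y1 != 0 ->
  c23 C * x0 ^+ 2 = y1 -> c00 C * (x0 ^+ 4 * y1) = q ->
  L_isomorphic C (Params q 0 0 0 0 0 0 1 0 0).
Proof.
case: C => d00 d01 d11 d12 d13 d14 d15 d23 d24 d34 /= -> -> -> -> ->.
move=> x0N0 y1N0 E23 <-.
have {E23} -> : d23 = y1 / x0 ^+ 2 by rewrite -E23 mulfK ?expf_neq0.
have n2 : (2 : K) != 0 by rewrite pnatr_eq0.
have n3 : (3 : K) != 0 by rewrite pnatr_eq0.
have [x1 ->] : exists x1, d24 = - 3 * x1 * y1 / x0 ^+ 4.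
  by exists (- d24 * x0 ^+ 4 / (3 * y1)); field; rewrite ?n3 ?x0N0 ?y1N0.
have [y3 ->] : exists y3, d14 = - 2 * y3 / x0 ^+ 4.
  by exists (- d14 * x0 ^+ 4 / 2); field; rewrite ?n2 ?x0N0.
have [y4 ->] : exists y4, d15 = (- 3 * y4 * x0 + 6 * x1 * y3) / x0 ^+ 6.
  exists ((6 * x1 * y3 - d15 * x0 ^+ 6) / (3 * x0)).
  by field; rewrite ?n3 ?x0N0.
apply: (@adapted_iso _ _ _ (vec8 x0 x1 0 0 0 0 0 0) (vec8 0 y1 0 y3 y4 0 0 0)).
  by rewrite /TLeib8 /=; ring.
apply: adapted_coordinates; rewrite ?mul0r ?addr0 //; try by rewrite L_vec8 /=.
all: rewrite !L_vec8 /= ?vec8N ?vec8Z ?vec8D; congr vec8.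
all: by field; rewrite ?n2 ?n3 ?x0N0 ?y1N0.
Qed.

(** The value of c13 determines x1; those of c14 and c15 follow, as they must by
    [iso_c12_catalan]. *)
Lemma iso_c12 C (q x0 : K) :
  c34 C = 0 -> c23 C = 0 -> c24 C = 0 -> c11 C = 0 -> c01 C = 0 ->
  c12 C != 0 -> 4 * c14 C * c12 C - 5 * c13 C ^+ 2 = 0 ->
  - 7 * c13 C ^+ 3 + 4 * c15 C * c12 C ^+ 2 = 0 ->
  x0 != 0 -> c00 C * (c12 C * x0 ^+ 6) = q ->
  L_isomorphic C (Params q 0 0 1 0 0 0 0 0 0).
Proof.
case: C => d00 d01 d11 d12 d13 d14 d15 d23 d24 d34 /= -> -> -> -> ->.
move=> d12N0 E14 E15 x0N0 <-.
have n2 : (2 : K) != 0 by rewrite pnatr_eq0.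
have n4 : (4 : K) != 0 by rewrite pnatr_eq0.
have -> : d14 = 5 * d13 ^+ 2 / (4 * d12).
  apply: (eq_by_combination E14 (k := 4 * d12)); first by rewrite mulf_neq0.
  by field; rewrite ?n4.
have -> : d15 = 7 * d13 ^+ 3 / (4 * d12 ^+ 2).
  apply: (eq_by_combination E15 (k := 4 * d12 ^+ 2)).
    by rewrite mulf_neq0 ?expf_neq0.
  by field; rewrite ?n4.
pose x1 := d13 * x0 ^+ 2 / (2 * d12); pose y1 := d12 * x0 ^+ 2.
apply: (@adapted_iso _ _ _ (vec8 x0 x1 0 0 0 0 0 0) (vec8 0 y1 0 0 0 0 0 0)).
  by rewrite /TLeib8 /=; ring.
apply: adapted_coordinates; rewrite ?mulf_neq0 ?expf_neq0 ?mul0r ?addr0 //;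
  try by rewrite L_vec8 /=.
all: rewrite !L_vec8 /= ?vec8N ?vec8Z ?vec8D; congr vec8; rewrite /x1 /y1.
all: by field; rewrite ?n2 ?n4 ?x0N0.
Qed.

(** The value of c15 is reached by x1. *)
Lemma iso_c13 C (q x0 y1 : K) :
  c34 C = 0 -> c23 C = 0 -> c24 C = 0 -> c12 C = 0 -> c14 C = 0 ->
  c11 C = 0 -> c01 C = 0 -> x0 != 0 -> y1 != 0 ->
  c13 C * x0 ^+ 3 = y1 -> c00 C * (x0 ^+ 4 * y1) = q ->
  L_isomorphic C (Params q 0 0 0 1 0 0 0 0 0).
Proof.
case: C => d00 d01 d11 d12 d13 d14 d15 d23 d24 d34 /= -> -> -> -> -> -> ->.
move=> x0N0 y1N0 E13 <-.
have {E13} -> : d13 = y1 / x0 ^+ 3 by rewrite -E13 mulfK ?expf_neq0.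
have n3 : (3 : K) != 0 by rewrite pnatr_eq0.
have [x1 ->] : exists x1, d15 = 3 * x1 * y1 / x0 ^+ 6.
  by exists (d15 * x0 ^+ 6 / (3 * y1)); field; rewrite ?n3 ?x0N0 ?y1N0.
apply: (@adapted_iso _ _ _ (vec8 x0 x1 0 0 0 0 0 0) (vec8 0 y1 0 0 0 0 0 0)).
  by rewrite /TLeib8 /=; ring.
apply: adapted_coordinates; rewrite ?mul0r ?addr0 //; try by rewrite L_vec8 /=.
all: rewrite !L_vec8 /= ?vec8N ?vec8Z ?vec8D; congr vec8.
all: by field; rewrite ?n3 ?x0N0 ?y1N0.
Qed.

Lemma iso_c14_c15 C (q00 q01 q11 b c x0 x1 y1 : K) (l := x0 ^+ 6 * y1) :
  c34 C = 0 -> c23 C = 0 -> c24 C = 0 -> c12 C = 0 -> c13 C = 0 ->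
  x0 != 0 -> y1 != 0 ->
  c14 C * x0 ^+ 4 = b * y1 -> c15 C * x0 ^+ 5 = c * y1 ->
  c11 C * l = q11 * y1 ^+ 2 -> c01 C * l = q01 * x0 * y1 + 2 * q11 * x1 * y1 ->
  c00 C * l = q00 * x0 ^+ 2 + q01 * x0 * x1 + q11 * x1 ^+ 2 ->
  L_isomorphic C (Params q00 q01 q11 0 0 b c 0 0 0).
Proof.
case: C => d00 d01 d11 d12 d13 d14 d15 d23 d24 d34 /= -> -> -> -> ->.
move=> x0N0 y1N0 E14 E15 E11 E01 E00.
have lN0 : l != 0 by rewrite mulf_neq0 ?expf_neq0.
have {E14} -> : d14 = b * y1 / x0 ^+ 4 by rewrite -E14 mulfK ?expf_neq0.
have {E15} -> : d15 = c * y1 / x0 ^+ 5 by rewrite -E15 mulfK ?expf_neq0.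
have {E11} -> : d11 = q11 * y1 ^+ 2 / l by rewrite -E11 mulfK.
have {E01} -> : d01 = (q01 * x0 * y1 + 2 * q11 * x1 * y1) / l.
  by rewrite -E01 mulfK.
have {E00} -> : d00 = (q00 * x0 ^+ 2 + q01 * x0 * x1 + q11 * x1 ^+ 2) / l.
  by rewrite -E00 mulfK.
apply: (@adapted_iso _ _ _ (vec8 x0 x1 0 0 0 0 0 0) (vec8 0 y1 0 0 0 0 0 0)).
  by rewrite /TLeib8 /=; ring.
apply: adapted_coordinates; rewrite ?mul0r ?addr0 //; try by rewrite L_vec8 /=.
all: rewrite !L_vec8 /= ?vec8N ?vec8Z ?vec8D; congr vec8; rewrite /l.
all: by field; rewrite ?x0N0 ?y1N0.
Qed.

End Constructions.

(** * Orbits *)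

Lemma alg_isomorphic_sym (K : fieldType) (V W : lmodType K) mulV mulW :
  @alg_isomorphic K V W mulV mulW -> alg_isomorphic mulW mulV.
Proof.
case=> f [[g fK gK] fM].
have gL : linear g := GRing.can2_linear fK gK.
pose G := GRing.isLinear.Build K W V *:%R g gL.
exists (HB.pack g G : {linear W -> V}); split; first by exists f.
by move=> x y; apply: (can_inj fK); rewrite fM !gK.
Qed.

Lemma alg_isomorphic_trans (K : fieldType) (U V W : lmodType K) mulU mulV mulW :
  @alg_isomorphic K U V mulU mulV -> @alg_isomorphic K V W mulV mulW ->
  alg_isomorphic mulU mulW.
Proof.
case=> f [f_bij fM] [g [g_bij gM]]; exists (g \o f : {linear U -> W}).
by split=> [|x y /=]; [exact: bij_comp | rewrite fM gM].
Qed.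

Lemma single_orbit_representative (K : fieldType) (U : params K -> Prop) C0 :
  U C0 -> (forall C, U C -> L_isomorphic C C0) ->
  (forall C, TLeib8 C -> L_isomorphic C C0 -> U C) -> single_orbit U C0.
Proof.
move=> UC0 isoC0 UofIso; split=> // C D UC.
  move=> UD; apply: alg_isomorphic_trans (isoC0 C UC) _.
  exact/alg_isomorphic_sym/isoC0.
move=> TD isoCD; apply: UofIso => //.
exact: alg_isomorphic_trans (alg_isomorphic_sym isoCD) (isoC0 C UC).
Qed.

Section Orbits.
Variable K : numClosedFieldType.
Implicit Types C D : params K.

Lemma nonzero_root n (a b : K) : (0 < n)%N -> a != 0 -> b != 0 ->
  exists2 r, r != 0 & a * r ^+ n = b.
Proof.
move=> n0 a0 b0; exists (n.-root (b / a)); last first.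
  by rewrite rootCK // mulrC divfK.
by rewrite rootC_eq0 // mulf_neq0 ?invr_eq0.
Qed.

Lemma c23_eq0 C : TLeib8 C -> c34 C != 0 -> c12 C = 0 -> c23 C = 0.
Proof.
move=> + c34N0 c120; rewrite /TLeib8 c120 mulr0 addr0 => /eqP.
by rewrite mulf_eq0 (negPf c34N0) => /eqP.
Qed.

Ltac nonzero := by rewrite ?mulf_neq0 ?expf_neq0 ?oner_eq0.

Ltac representative_in_U :=
  repeat split; rewrite /TLeib8 /= ?(mul0r, mulr0, mulr1, addr0, expr0n) //=;
  by apply/eqP; rewrite ?subr0 ?oner_eq0 ?pnatr_eq0.

(** With [iso] an isomorphism from L(C) to a representative whose parameters are
    numerals, reads off each condition on C from [iso_vanishing], whose premises
    on the representative then hold by computation; conditions that are not of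
    this kind are left. *)
Ltac vanish TC iso :=
  have [? ? ? ? [? ? ? ? [? ? ?]]] := iso_vanishing iso;
  repeat split; first exact TC;
  match goal with
  | H : ?P |- ?c <> 0 =>
     match P with context [c = 0 <-> _] =>
       let E := fresh in
       intro E; apply H in E; [|reflexivity..]; move: E => /=; apply/eqP;
       rewrite ?expr0n /= ?mulr1 ?subr0 ?oner_eq0 ?pnatr_eq0 //
     end
  | H : ?P |- ?c = 0 =>
     match P with context [c = 0 <-> _] =>
       apply H; try reflexivity; rewrite /= ?expr0n ?mulr0 ?mul0r ?subr0 //
     end
  | _ => idtac
  end.

(** The value of c13 fixes y1 in terms of x0 = r, and the condition on c00 is
    then an equation in r alone; the exponents of the roots for the other sets
    arise from a similar elimination. *)
Lemma orbit_U5 : single_orbit (@U5 K) (Params 1 0 0 0 1 0 0 0 0 1).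
Proof.
apply: single_orbit_representative; first by representative_in_U.
  move=> C [TC [/eqP c34N0 [c110 [c010
    [c120 [/eqP c13N0 [c140 /eqP c00N0]]]]]]].
  have c230 := c23_eq0 TC c34N0 c120.
  have [r rN0 rE] : exists2 r, r != 0 & c00 C * c13 C ^+ 2 * r ^+ 9 = c34 C.
    by apply: nonzero_root => //; nonzero.
  apply: (iso_c34 (x0 := r) (y1 := c13 C * r ^+ 3)) => //;
    rewrite ?c140; try nonzero; ring: rE.
by move=> C TC iso; vanish TC iso.
Qed.

Lemma orbit_U6 : single_orbit (@U6 K) (Params 0 0 0 0 1 0 0 0 0 1).
Proof.
apply: single_orbit_representative; first by representative_in_U.
  move=> C [TC [/eqP c34N0 [c110 [c010 [c120 [/eqP c13N0 [c140 c000]]]]]]].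
  have c230 := c23_eq0 TC c34N0 c120.
  apply: (iso_c34 (x0 := 1) (y1 := c13 C)) => //;
    rewrite ?c140 ?c000; try nonzero; ring.
by move=> C TC iso; vanish TC iso.
Qed.

Lemma orbit_U7 : single_orbit (@U7 K) (Params 1 0 0 0 0 1 0 0 0 1).
Proof.
apply: single_orbit_representative; first by representative_in_U.
  move=> C [TC [/eqP c34N0 [c110 [c010
    [c120 [c130 [/eqP c14N0 /eqP c00N0]]]]]]].
  have c230 := c23_eq0 TC c34N0 c120.
  have [r rN0 rE] : exists2 r, r != 0 & c00 C * c14 C ^+ 2 * r ^+ 11 = c34 C.
    by apply: nonzero_root => //; nonzero.
  apply: (iso_c34 (x0 := r) (y1 := c14 C * r ^+ 4)) => //;
    rewrite ?c130; try nonzero; ring: rE.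
by move=> C TC iso; vanish TC iso.
Qed.

Lemma orbit_U8 : single_orbit (@U8 K) (Params 0 0 0 0 0 1 0 0 0 1).
Proof.
apply: single_orbit_representative; first by representative_in_U.
  move=> C [TC [/eqP c34N0 [c110 [c010 [c120 [c130 [/eqP c14N0 c000]]]]]]].
  have c230 := c23_eq0 TC c34N0 c120.
  apply: (iso_c34 (x0 := 1) (y1 := c14 C)) => //;
    rewrite ?c130 ?c000; try nonzero; ring.
by move=> C TC iso; vanish TC iso.
Qed.

Lemma orbit_U9 : single_orbit (@U9 K) (Params 1 0 0 0 0 0 0 0 0 1).
Proof.
apply: single_orbit_representative; first by representative_in_U.
  move=> C [TC [/eqP c34N0 [c110 [c010 [c120 [c130 [c140 /eqP c00N0]]]]]]].
  have c230 := c23_eq0 TC c34N0 c120.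
  have [r rN0 rE] : exists2 r, r != 0 & c00 C * r ^+ 3 = c34 C.
    by apply: nonzero_root => //; nonzero.
  apply: (iso_c34 (x0 := r) (y1 := 1)) => //;
    rewrite ?c130 ?c140; try nonzero; ring: rE.
by move=> C TC iso; vanish TC iso.
Qed.

Lemma orbit_U10 : single_orbit (@U10 K) (Params 0 0 0 0 0 0 0 0 0 1).
Proof.
apply: single_orbit_representative; first by representative_in_U.
  move=> C [TC [/eqP c34N0 [c110 [c010 [c120 [c130 [c140 c000]]]]]]].
  have c230 := c23_eq0 TC c34N0 c120.
  apply: (iso_c34 (x0 := 1) (y1 := 1)) => //;
    rewrite ?c130 ?c140 ?c000; try nonzero; ring.
by move=> C TC iso; vanish TC iso.
Qed.

Lemma orbit_U17 : single_orbit (@U17 K) (Params 1 0 0 0 0 0 0 1 0 0).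
Proof.
apply: single_orbit_representative; first by representative_in_U.
  move=> C [TC [c340 [/eqP c23N0 [c110 [c010 [c120 [c130 /eqP c00N0]]]]]]].
  have [r rN0 rE] : exists2 r, r != 0 & c00 C * c23 C * r ^+ 6 = 1.
    by apply: nonzero_root => //; nonzero.
  apply: (iso_c23 (x0 := r) (y1 := c23 C * r ^+ 2)) => //;
    try nonzero; ring: rE.
by move=> C TC iso; vanish TC iso.
Qed.

Lemma orbit_U18 : single_orbit (@U18 K) (Params 0 0 0 0 0 0 0 1 0 0).
Proof.
apply: single_orbit_representative; first by representative_in_U.
  move=> C [TC [c340 [/eqP c23N0 [c110 [c010 [c120 [c130 c000]]]]]]].
  apply: (iso_c23 (x0 := 1) (y1 := c23 C)) => //;
    rewrite ?c000; try nonzero; ring.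
by move=> C TC iso; vanish TC iso.
Qed.

Lemma orbit_U29 : single_orbit (@U29 K) (Params 1 0 0 1 0 0 0 0 0 0).
Proof.
apply: single_orbit_representative; first by representative_in_U.
  move=> C [TC [c340 [c230 [c240 [/eqP c12N0
    [E14 [E15 [c110 [c010 /eqP c00N0]]]]]]]]].
  have [r rN0 rE] : exists2 r, r != 0 & c00 C * c12 C * r ^+ 6 = 1.
    by apply: nonzero_root => //; nonzero.
  by apply: (iso_c12 (x0 := r)) => //; ring: rE.
move=> C TC iso; have [E14 E15] := iso_c12_catalan iso.
by vanish TC iso; [rewrite E14 subrr | rewrite -E15; ring].
Qed.

Lemma orbit_U30 : single_orbit (@U30 K) (Params 0 0 0 1 0 0 0 0 0 0).
Proof.
apply: single_orbit_representative; first by representative_in_U.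
  move=> C [TC [c340 [c230 [c240 [/eqP c12N0
    [E14 [E15 [c110 [c010 c000]]]]]]]]].
  by apply: (iso_c12 (x0 := 1)) => //; rewrite ?oner_eq0 // c000 mul0r.
move=> C TC iso; have [E14 E15] := iso_c12_catalan iso.
by vanish TC iso; [rewrite E14 subrr | rewrite -E15; ring].
Qed.

Lemma orbit_U34 : single_orbit (@U34 K) (Params 1 0 0 0 1 0 0 0 0 0).
Proof.
apply: single_orbit_representative; first by representative_in_U.
  move=> C [TC [c340 [c230 [c240 [c120
    [/eqP c13N0 [c140 [c110 [c010 /eqP c00N0]]]]]]]]].
  have [r rN0 rE] : exists2 r, r != 0 & c00 C * c13 C * r ^+ 7 = 1.
    by apply: nonzero_root => //; nonzero.
  apply: (iso_c13 (x0 := r) (y1 := c13 C * r ^+ 3)) => //;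
    try nonzero; ring: rE.
by move=> C TC iso; vanish TC iso.
Qed.

Lemma orbit_U35 : single_orbit (@U35 K) (Params 0 0 0 0 1 0 0 0 0 0).
Proof.
apply: single_orbit_representative; first by representative_in_U.
  move=> C [TC [c340 [c230 [c240 [c120
    [/eqP c13N0 [c140 [c110 [c010 c000]]]]]]]]].
  apply: (iso_c13 (x0 := 1) (y1 := c13 C)) => //;
    rewrite ?c000; try nonzero; ring.
by move=> C TC iso; vanish TC iso.
Qed.

Lemma orbit_U38 : single_orbit (@U38 K) (Params 1 0 1 0 0 0 0 0 0 0).
Proof.
apply: single_orbit_representative; first by representative_in_U.
  move=> C [TC [c340 [c230 [c240 [c120
    [c130 [/eqP c11N0 [c150 [c140 /eqP DN0]]]]]]]]].
  have n2 : (2 : K) != 0 by rewrite pnatr_eq0.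
  have [r rN0 rE] : exists2 r, r != 0 &
      (4 * c00 C * c11 C - c01 C ^+ 2) * r ^+ 10 = 4.
    by apply: nonzero_root; rewrite ?pnatr_eq0.
  (* Here c01 forces x1, c11 forces y1, and the discriminant forces r^10. *)
  apply: (iso_c14_c15 (x0 := r) (x1 := c01 C * r ^+ 6 / 2)
                      (y1 := c11 C * r ^+ 6)) => //;
    rewrite ?c150 ?c140; try nonzero; try by field.
  apply: (eq_by_combination (k := 4) (congr1 (fun z => z * r ^+ 2) rE)).
    by rewrite pnatr_eq0.
  by field.
by move=> C TC iso; vanish TC iso.
Qed.

Lemma orbit_U39 : single_orbit (@U39 K) (Params 0 0 1 0 0 0 0 0 0 0).
Proof.
apply: single_orbit_representative; first by representative_in_U.
  move=> C [TC [c340 [c230 [c240 [c120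
    [c130 [/eqP c11N0 [c150 [c140 ED]]]]]]]]].
  have n2 : (2 : K) != 0 by rewrite pnatr_eq0.
  apply: (iso_c14_c15 (x0 := 1) (x1 := c01 C / 2) (y1 := c11 C)) => //;
    rewrite ?c150 ?c140; try nonzero; try by field.
  apply: (eq_by_combination (k := 4) ED); first by rewrite pnatr_eq0.
  by field.
by move=> C TC iso; vanish TC iso.
Qed.

Lemma orbit_U41 : single_orbit (@U41 K) (Params 0 1 0 0 0 1 0 0 0 0).
Proof.
apply: single_orbit_representative; first by representative_in_U.
  move=> C [TC [c340 [c230 [c240 [c120
    [c130 [c110 [/eqP c01N0 [c150 /eqP c14N0]]]]]]]]].
  have [r rN0 rE] : exists2 r, r != 0 & c01 C * r ^+ 5 = 1.
    by apply: nonzero_root => //; nonzero.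
  apply: (iso_c14_c15 (x0 := r) (x1 := c00 C * (c14 C * r ^+ 4) * r ^+ 5)
                      (y1 := c14 C * r ^+ 4)) => //;
    rewrite ?c110 ?c150; try nonzero; ring: rE.
by move=> C TC iso; vanish TC iso.
Qed.

Lemma orbit_U42 : single_orbit (@U42 K) (Params 0 1 0 0 0 0 0 0 0 0).
Proof.
apply: single_orbit_representative; first by representative_in_U.
  move=> C [TC [c340 [c230 [c240 [c120
    [c130 [c110 [/eqP c01N0 [c150 c140]]]]]]]]].
  have [r rN0 rE] : exists2 r, r != 0 & c01 C * r ^+ 5 = 1.
    by apply: nonzero_root => //; nonzero.
  apply: (iso_c14_c15 (x0 := r) (x1 := c00 C * r ^+ 5) (y1 := 1)) => //;
    rewrite ?c110 ?c150 ?c140; try nonzero; ring: rE.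
by move=> C TC iso; vanish TC iso.
Qed.

Lemma orbit_U44 : single_orbit (@U44 K) (Params 1 0 0 0 0 1 0 0 0 0).
Proof.
apply: single_orbit_representative; first by representative_in_U.
  move=> C [TC [c340 [c230 [c240 [c120
    [c130 [c110 [c010 [/eqP c14N0 [c150 /eqP c00N0]]]]]]]]]].
  have [r rN0 rE] : exists2 r, r != 0 & c00 C * c14 C * r ^+ 8 = 1.
    by apply: nonzero_root => //; nonzero.
  apply: (iso_c14_c15 (x0 := r) (x1 := 0) (y1 := c14 C * r ^+ 4)) => //;
    rewrite ?c110 ?c010 ?c150; try nonzero; ring: rE.
by move=> C TC iso; vanish TC iso.
Qed.

Lemma orbit_U45 : single_orbit (@U45 K) (Params 0 0 0 0 0 1 0 0 0 0).
Proof.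
apply: single_orbit_representative; first by representative_in_U.
  move=> C [TC [c340 [c230 [c240 [c120
    [c130 [c110 [c010 [/eqP c14N0 [c150 c000]]]]]]]]]].
  apply: (iso_c14_c15 (x0 := 1) (x1 := 0) (y1 := c14 C)) => //;
    rewrite ?c110 ?c010 ?c150 ?c000; try nonzero; ring.
by move=> C TC iso; vanish TC iso.
Qed.

Lemma orbit_U46 : single_orbit (@U46 K) (Params 1 0 0 0 0 0 1 0 0 0).
Proof.
apply: single_orbit_representative; first by representative_in_U.
  move=> C [TC [c340 [c230 [c240 [c120
    [c130 [c110 [c010 [c140 [/eqP c15N0 /eqP c00N0]]]]]]]]]].
  have [r rN0 rE] : exists2 r, r != 0 & c00 C * c15 C * r ^+ 9 = 1.
    by apply: nonzero_root => //; nonzero.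
  apply: (iso_c14_c15 (x0 := r) (x1 := 0) (y1 := c15 C * r ^+ 5)) => //;
    rewrite ?c110 ?c010 ?c140; try nonzero; ring: rE.
by move=> C TC iso; vanish TC iso.
Qed.

Lemma orbit_U47 : single_orbit (@U47 K) (Params 0 0 0 0 0 0 1 0 0 0).
Proof.
apply: single_orbit_representative; first by representative_in_U.
  move=> C [TC [c340 [c230 [c240 [c120
    [c130 [c110 [c010 [c140 [/eqP c15N0 c000]]]]]]]]]].
  apply: (iso_c14_c15 (x0 := 1) (x1 := 0) (y1 := c15 C)) => //;
    rewrite ?c110 ?c010 ?c140 ?c000; try nonzero; ring.
by move=> C TC iso; vanish TC iso.
Qed.

Lemma orbit_U48 : single_orbit (@U48 K) (Params 1 0 0 0 0 0 0 0 0 0).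
Proof.
apply: single_orbit_representative; first by representative_in_U.
  move=> C [TC [c340 [c230 [c240 [c120
    [c130 [c110 [c010 [c140 [c150 /eqP c00N0]]]]]]]]]].
  have [r rN0 rE] : exists2 r, r != 0 & c00 C * r ^+ 4 = 1.
    by apply: nonzero_root => //; nonzero.
  apply: (iso_c14_c15 (x0 := r) (x1 := 0) (y1 := 1)) => //;
    rewrite ?c110 ?c010 ?c140 ?c150; try nonzero; ring: rE.
by move=> C TC iso; vanish TC iso.
Qed.

Lemma orbit_U49 : single_orbit (@U49 K) (Params 0 0 0 0 0 0 0 0 0 0).
Proof.
apply: single_orbit_representative; first by representative_in_U.
  move=> C [TC [c340 [c230 [c240 [c120
    [c130 [c110 [c010 [c140 [c150 c000]]]]]]]]]].
  apply: (iso_c14_c15 (x0 := 1) (x1 := 0) (y1 := 1)) => //;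
    rewrite ?c110 ?c010 ?c140 ?c150 ?c000; try nonzero; ring.
by move=> C TC iso; vanish TC iso.
Qed.

End Orbits.

Theorem proposition2p41 (R : realType) :
  single_orbit (@U5 R[i]) (Params 1 0 0 0 1 0 0 0 0 1) /\
  single_orbit (@U6 R[i]) (Params 0 0 0 0 1 0 0 0 0 1) /\
  single_orbit (@U7 R[i]) (Params 1 0 0 0 0 1 0 0 0 1) /\
  single_orbit (@U8 R[i]) (Params 0 0 0 0 0 1 0 0 0 1) /\
  single_orbit (@U9 R[i]) (Params 1 0 0 0 0 0 0 0 0 1) /\
  single_orbit (@U10 R[i]) (Params 0 0 0 0 0 0 0 0 0 1) /\
  single_orbit (@U17 R[i]) (Params 1 0 0 0 0 0 0 1 0 0) /\
  single_orbit (@U18 R[i]) (Params 0 0 0 0 0 0 0 1 0 0) /\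
  single_orbit (@U29 R[i]) (Params 1 0 0 1 0 0 0 0 0 0) /\
  single_orbit (@U30 R[i]) (Params 0 0 0 1 0 0 0 0 0 0) /\
  single_orbit (@U34 R[i]) (Params 1 0 0 0 1 0 0 0 0 0) /\
  single_orbit (@U35 R[i]) (Params 0 0 0 0 1 0 0 0 0 0) /\
  single_orbit (@U38 R[i]) (Params 1 0 1 0 0 0 0 0 0 0) /\
  single_orbit (@U39 R[i]) (Params 0 0 1 0 0 0 0 0 0 0) /\
  single_orbit (@U41 R[i]) (Params 0 1 0 0 0 1 0 0 0 0) /\
  single_orbit (@U42 R[i]) (Params 0 1 0 0 0 0 0 0 0 0) /\
  single_orbit (@U44 R[i]) (Params 1 0 0 0 0 1 0 0 0 0) /\
  single_orbit (@U45 R[i]) (Params 0 0 0 0 0 1 0 0 0 0) /\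
  single_orbit (@U46 R[i]) (Params 1 0 0 0 0 0 1 0 0 0) /\
  single_orbit (@U47 R[i]) (Params 0 0 0 0 0 0 1 0 0 0) /\
  single_orbit (@U48 R[i]) (Params 1 0 0 0 0 0 0 0 0 0) /\
  single_orbit (@U49 R[i]) (Params 0 0 0 0 0 0 0 0 0 0).
Proof.
split; first exact: orbit_U5.
split; first exact: orbit_U6.
split; first exact: orbit_U7.
split; first exact: orbit_U8.
split; first exact: orbit_U9.
split; first exact: orbit_U10.
split; first exact: orbit_U17.
split; first exact: orbit_U18.
split; first exact: orbit_U29.
split; first exact: orbit_U30.
split; first exact: orbit_U34.
split; first exact: orbit_U35.
split; first exact: orbit_U38.
split; first exact: orbit_U39.
split; first exact: orbit_U41.
split; first exact: orbit_U42.
split; first exact: orbit_U44.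
split; first exact: orbit_U45.
split; first exact: orbit_U46.
split; first exact: orbit_U47.
split; first exact: orbit_U48.
exact: orbit_U49.
Qed.
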